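(* Let $k$ be a positive integer. Let $A$ be a set of positive integers such that $\{a, a+k\} \subseteq A$ for infinitely many $a \in A$, and such that $\{a, a+k\} \cap A \neq \emptyset$ for every positive integer $a$. Then $A$ contains infinitely many subsets of the form $\{a, ax^2\}$ for some integer $x \geq 2$. *)

(* Defs.v *)
From mathcomp Require Export all_boot.
From mathcomp Require Export boolp classical_sets cardinality.

(* Main.v *)
(** With [y = 16ak+1], the identity
    [a (2k(16ak+3))^2 + k = (a (2k)^2 + k) y^2] holds.
    For [a] in [A], if neither [{a, a(2k)^2}] nor [{a, a(2k(16ak+3))^2}] lies
    in [A], then the covering hypothesis puts both [a(2k)^2 + k] and its multiple
    by [y^2] in [A].  So every [a] in [A] yields a pair with minimum at
    least [a]. *)
Require Import Defs.
From mathcomp Require Import ring zify.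
Set Implicit Arguments.
Unset Strict Implicit.
Unset Printing Implicit Defensive.
Local Open Scope nat_scope.
Local Open Scope classical_set_scope.

Lemma finite_set_nat_bounded (B : set nat) :
  finite_set B -> exists n, forall b, B b -> b <= n.
Proof.
move=> /finite_seqP[s ->]; exists (\max_(i <- s) i) => b /= bs.
by rewrite (big_rem b) //= leq_maxl.
Qed.

Lemma square_multiple_pair_ge (k : nat) (A : set nat) (a : nat) :
    0 < k -> (forall a, 0 < a -> [set a; a + k] `&` A !=set0) ->
    0 < a -> A a ->
  exists b x, [/\ a <= b, 2 <= x, A b & A (b * x ^ 2)].
Proof.
move=> k0 Ameet a0 Aa.
have shift c : 0 < c -> ~ A c -> A (c + k).
  by move=> c0 nAc; have [d [[->|->] //]] := Ameet c c0.
have [Au|nAu] := pselect (A (a * (2 * k) ^ 2)).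
  by exists a, (2 * k); split=> //; lia.
(* With [m = 4ak] and [x = 2kz], the equation [a x^2 + k = (a (2k)^2 + k) y^2] becomes the Pell-type
   equation [(m+1) y^2 - m z^2 = 1]. The cube of [sqrt (m+1) + sqrt m] gives its solution
   [y = 4m+1], [z = 4m+3]. *)
set x := 2 * k * (16 * a * k + 3).
have x2 : 2 <= x by rewrite /x; nia.
have [Av|nAv] := pselect (A (a * x ^ 2)); first by exists a, x.
exists (a * (2 * k) ^ 2 + k), (16 * a * k + 1).
have k21 : 0 < (2 * k) ^ 2 by rewrite expn_gt0; lia.
split; [by nia | by nia | by apply: shift => //; rewrite muln_gt0 a0 |].
have -> : (a * (2 * k) ^ 2 + k) * (16 * a * k + 1) ^ 2 = a * x ^ 2 + k.
  by rewrite /x; ring.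
by apply: shift => //; rewrite muln_gt0 a0 expn_gt0; lia.
Qed.

Theorem theorem4 (k : nat) (k_gt0 : 0 < k) (A : set nat)
  (A_pos : forall a : nat, A a -> 0 < a)
  (A_inf : infinite_set [set a : nat | A a /\ [set a; a + k] `<=` A])
  (A_meet : forall a : nat, 0 < a -> [set a; a + k] `&` A !=set0) :
  infinite_set [set S : set nat | S `<=` A /\
    exists a x : nat, 2 <= x /\ S = [set a; a * x ^ 2]].
Proof.
set F := (X in infinite_set X) => finF.
(* If [F] is finite, [n] bounds all entries of its pairs; since each [a] in [A] lies below some
   pair, [n] then bounds [A]. *)
have /finite_set_nat_bounded[n ub_n] : finite_set (\bigcup_(S in F) S).
  by apply: bigcup_finite => // S [_ [a [x [_ ->]]]]; exact: finite_set2.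
apply: A_inf; apply: (@sub_finite_set _ _ `I_n.+1); last exact: finite_II.
move=> a /= [Aa _]; rewrite ltnS.
have [b [x [ab x2 Ab Abx]]] :=
  square_multiple_pair_ge k_gt0 A_meet (A_pos _ Aa) Aa.
apply: leq_trans ab (ub_n _ _); exists [set b; b * x ^ 2]; last by left.
by split; [move=> c [->|->] | exists b, x].
Qed.
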